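(* Let $\mathsf h$ and $\mathsf H$ be Hilbert spaces, let $F=\begin{bmatrix}K&M\\L&C-I\end{bmatrix}\in\mathfrak{qc}(\mathsf h\oplus\mathsf H)$ and set $\beta_0=\beta_0(F)$. Set $$F_1=\begin{bmatrix}\beta_0I_{\mathsf h}+i\,\mathrm{Im}K&0\\0&0\end{bmatrix},\quad F_2^{\ell}=\begin{bmatrix}-\frac12L^*L&-L^*\\L&0\end{bmatrix},\quad F_3^{r}=\begin{bmatrix}-\frac12MM^*&M\\-M^*&0\end{bmatrix},$$ $$F_3^{\ell}=\begin{bmatrix}\mathrm{Re}K+\frac12L^*L-\beta_0I_{\mathsf h}&M+L^*C\\0&C-I\end{bmatrix},\quad F_2^{r}=\begin{bmatrix}\mathrm{Re}K+\frac12MM^*-\beta_0I_{\mathsf h}&0\\L+CM^*&C-I\end{bmatrix}.$$ Then $F_1\in\mathfrak z(\mathsf h\oplus\mathsf H)$; $F_2^{\ell},F_3^{r}\in\mathfrak u(\mathsf h\oplus\mathsf H)$; $F_2^{r},F_3^{\ell}\in\mathfrak c(\mathsf h\oplus\mathsf H)$; and $$F_1\lhd F_2^{\ell}\lhd F_3^{\ell}=F=F_1\lhd F_2^{r}\lhd F_3^{r}.$$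
   Context: All Hilbert spaces are complex. Operators on $\mathsf h\oplus\mathsf H$ are written as block matrices. $\Delta:=\begin{bmatrix}0&0\\0&I_{\mathsf H}\end{bmatrix}$, $\Delta^\perp:=I-\Delta$, and for $F_1,F_2\in B(\mathsf h\oplus\mathsf H)$ the (associative) series product is $F_1\lhd F_2:=F_1+F_1\Delta F_2+F_2$. Set $\mathfrak z(\mathsf h\oplus\mathsf H):=\{K\oplus0_{\mathsf H}:K\in B(\mathsf h)\}$; $\mathfrak c(\mathsf h\oplus\mathsf H):=\{F\in B(\mathsf h\oplus\mathsf H):F^*\lhd F\le0\}$; $\mathfrak{qc}(\mathsf h\oplus\mathsf H):=\mathfrak c(\mathsf h\oplus\mathsf H)+\mathbb R_+\Delta^\perp$; $\mathfrak u(\mathsf h\oplus\mathsf H):=\{F:F^*\lhd F=0=F\lhd F^*\}$; and for $F\in\mathfrak{qc}(\mathsf h\oplus\mathsf H)$, $\beta_0(F):=\inf\{\beta\in\mathbb R:F-\beta\Delta^\perp\in\mathfrak c(\mathsf h\oplus\mathsf H)\}$. $\mathrm{Re}K=\frac12(K+K^* )$ and $\mathrm{Im}K=\frac1{2i}(K-K^* )$. *)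

(* Defs.v *)
From HB Require Import structures.
From mathcomp Require Import all_boot all_order all_algebra.
From mathcomp Require Import complex.
From mathcomp Require Import ring.
From mathcomp Require Import boolp classical_sets functions filter reals.
From mathcomp Require Import topology normedtype.

Set Implicit Arguments.
Unset Strict Implicit.
Unset Printing Implicit Defensive.

Import Order.TTheory GRing.Theory Num.Theory.
Import numFieldNormedType.Exports.

Local Open Scope classical_set_scope.
Local Open Scope ring_scope.

(** * Complex Hilbert spaces *)

(* The inner product is linear in its first argument and conjugate-linear in
   the second one. *)
HB.mixin Record isHilbert (R : realType) V & CompleteNormedModule R[i] V := {
  hdot : {dot V for @Num.conj R[i]};
  hdotE : forall x : V, hdot x x = `|x| ^+ 2
}.

#[short(type="hilbertType")]
HB.structure Definition Hilbert (R : realType) :=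
  {V of CompleteNormedModule R[i] V & isHilbert R V}.

Arguments hdot {R s}.

Notation "⟨ x , y ⟩" := (hdot x y)
  (at level 0, x, y at level 60, format "⟨ x ,  y ⟩") : ring_scope.

(** * The Hilbert space direct sum *)

(* A copy of the product module: the library norms [U * V] by the maximum of
   the norms of the components. *)
Definition hsum (R : realType) (U V : hilbertType R) : Type := U * V.

Notation "U ⊕ V" := (hsum U V) (at level 50, left associativity) : type_scope.

Section DirectSum.
Context {R : realType} {U V : hilbertType R}.
Implicit Types x y z : U ⊕ V.

HB.instance Definition _ := GRing.Lmodule.copy (U ⊕ V) (U * V)%type.

Definition hsum_norm x : R[i] := sqrtC (`|x.1| ^+ 2 + `|x.2| ^+ 2).

Lemma hsum_normX2 x : hsum_norm x ^+ 2 = `|x.1| ^+ 2 + `|x.2| ^+ 2.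
Proof. by rewrite sqrtCK. Qed.

Lemma hsum_norm_ge0 x : 0 <= hsum_norm x.
Proof. by rewrite sqrtC_ge0 addr_ge0// exprn_ge0. Qed.

Lemma hsum_normD x y : hsum_norm (x + y) <= hsum_norm x + hsum_norm y.
Proof.
rewrite -(@ler_pXn2r _ 2)// ?nnegrE ?addr_ge0 ?hsum_norm_ge0//.
rewrite sqrrD !hsum_normX2/=.
have h : `|x.1| * `|y.1| + `|x.2| * `|y.2| <= hsum_norm x * hsum_norm y.
  rewrite -(@ler_pXn2r _ 2)// ?nnegrE ?(mulr_ge0, addr_ge0) ?hsum_norm_ge0//.
  rewrite exprMn !hsum_normX2 -subr_ge0.
  have -> : (`|x.1| ^+ 2 + `|x.2| ^+ 2) * (`|y.1| ^+ 2 + `|y.2| ^+ 2) -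
     (`|x.1| * `|y.1| + `|x.2| * `|y.2|) ^+ 2 =
     (`|x.1| * `|y.2| - `|x.2| * `|y.1|) ^+ 2 :> R[i] by ring.
  by rewrite real_exprn_even_ge0// realB// realM// normr_real.
apply: (@le_trans _ _ ((`|x.1| + `|y.1|) ^+ 2 + (`|x.2| + `|y.2|) ^+ 2)).
  by apply: lerD; rewrite ler_pXn2r ?nnegrE ?addr_ge0// ler_normD.
have -> : (`|x.1| + `|y.1|) ^+ 2 + (`|x.2| + `|y.2|) ^+ 2 =
   `|x.1| ^+ 2 + `|x.2| ^+ 2 + (`|x.1| * `|y.1| + `|x.2| * `|y.2|) *+ 2 +
   (`|y.1| ^+ 2 + `|y.2| ^+ 2) :> R[i] by ring.
by rewrite lerD2r lerD2l lerMn2r h orbT.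
Qed.

Lemma hsum_normZ (a : R[i]) x : hsum_norm (a *: x) = `|a| * hsum_norm x.
Proof.
apply/eqP; rewrite -(@eqrXn2 _ 2)// ?mulr_ge0 ?hsum_norm_ge0// exprMn.
by rewrite !hsum_normX2/= !normrZ !exprMn mulrDr.
Qed.

Lemma hsum_norm0_eq0 x : hsum_norm x = 0 -> x = 0.
Proof.
move=> /eqP; rewrite sqrtC_eq0 paddr_eq0 ?exprn_ge0// !expf_eq0/= !normr_eq0.
by case: x => a b /= /andP[/eqP-> /eqP->].
Qed.

HB.instance Definition _ := @Lmodule_isNormed.Build R[i] (U ⊕ V)
  hsum_norm hsum_normD hsum_normZ hsum_norm0_eq0.

Lemma hsum_normE x : `|x| = sqrtC (`|x.1| ^+ 2 + `|x.2| ^+ 2).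
Proof. by []. Qed.

Lemma hsum_norm1 x : `|x.1| <= `|x|.
Proof.
rewrite -(@ler_pXn2r _ 2)// ?nnegrE// [leRHS]hsum_normX2.
by rewrite lerDl exprn_ge0.
Qed.

Lemma hsum_norm2 x : `|x.2| <= `|x|.
Proof.
rewrite -(@ler_pXn2r _ 2)// ?nnegrE// [leRHS]hsum_normX2.
by rewrite lerDr exprn_ge0.
Qed.

Lemma hsum_norm_le x : `|x| <= `|x.1| + `|x.2|.
Proof.
rewrite -(@ler_pXn2r _ 2)// ?nnegrE ?addr_ge0// [leLHS]hsum_normX2 sqrrD.
by rewrite lerD2r lerDl mulrn_wge0// mulr_ge0.
Qed.

Lemma hsum_complete (F : set_system (U ⊕ V)) :
  ProperFilter F -> cauchy F -> cvg F.
Proof.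
move=> FF /cauchy_ballP Fc.
have cauchy_comp (W : hilbertType R) (p : U ⊕ V -> W) :
    (forall x y, `|p x - p y| <= `|x - y|) -> cvg (p @ F).
  move=> p1; apply: cauchy_cvg; apply/cauchy_ballP => e e0.
  have [/= [A B] [FA FB] AB] := Fc e e0.
  exists (p @` A, p @` B) => /=.
    by split; [apply: filterS FA|apply: filterS FB] => x Ax /=; exists x.
  move=> [_ _] [/= [x Ax <-] [y By <-]].
  have := AB (x, y) (conj Ax By).
  by rewrite -!ball_normE /= => /(le_lt_trans _); apply; exact: p1.
have /cvg_ex[a Fa] := cauchy_comp _ fst (fun x y => hsum_norm1 (x - y)).
have /cvg_ex[b Fb] := cauchy_comp _ snd (fun x y => hsum_norm2 (x - y)).
apply/cvg_ex; exists ((a, b) : U ⊕ V).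
apply/cvgrPdist_lt => e e0.
have e20 : 0 < e / 2 by rewrite divr_gt0.
move/cvgrPdist_lt: Fa => /(_ _ e20) Fa.
move/cvgrPdist_lt: Fb => /(_ _ e20) Fb.
near=> z.
apply: le_lt_trans (hsum_norm_le _) _ => /=.
by rewrite [ltRHS]splitr ltrD//; near: z.
Unshelve. all: by end_near. Qed.

HB.instance Definition _ := @Uniform_isComplete.Build (U ⊕ V) hsum_complete.

Definition hsum_dot x y : R[i] := ⟨x.1, y.1⟩ + ⟨x.2, y.2⟩.

Lemma hsum_dot_bilinear : bilinear_for
  (@GRing.mul R[i]) (@Num.conj R[i] \; *%R) hsum_dot.
Proof.
split=> u a x y; rewrite /hsum_dot /=.
  by rewrite !linearPl/= mulrDr; ring.
by rewrite !linearPr/= mulrDr; ring.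
Qed.

HB.instance Definition _ :=
  @bilinear_isBilinear.Build R[i] (U ⊕ V) (U ⊕ V) R[i] _ _ hsum_dot
    hsum_dot_bilinear.

Lemma hsum_dotC x y :
  hsum_dot x y = (-1) ^+ false * Num.conj (hsum_dot y x).
Proof.
by rewrite mul1r rmorphD/= /hsum_dot (hermC hdot x.1) (hermC hdot x.2) !mul1r.
Qed.

HB.instance Definition _ :=
  @isHermitianSesquilinear.Build R[i] (U ⊕ V) false (@Num.conj R[i]) hsum_dot
    hsum_dotC.

Lemma hsum_dotE x : hsum_dot x x = `|x| ^+ 2.
Proof. by rewrite [RHS]hsum_normX2 -!hdotE. Qed.

Lemma hsum_dot_gt0 x : x != 0 -> 0 < hsum_dot x x.
Proof. by move=> x0; rewrite hsum_dotE exprn_gt0// normr_gt0. Qed.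

HB.instance Definition _ :=
  @isDotProduct.Build R[i] (U ⊕ V) hsum_dot hsum_dot_gt0.

HB.instance Definition _ := @isHilbert.Build R (U ⊕ V) hsum_dot hsum_dotE.

Lemma hdot_hsumE x y : ⟨x, y⟩ = ⟨x.1, y.1⟩ + ⟨x.2, y.2⟩.
Proof. by []. Qed.

End DirectSum.

(** * Bounded operators *)

Section BoundedOperators.
Context {R : realType} {U V : hilbertType R}.

(* For a linear map between normed modules, boundedness is continuity:
   [linear_bounded_continuous]. *)
Definition bounded_linear : {pred U -> V} :=
  [pred f : U -> V | `[< linear f /\ continuous f >]].

Lemma bounded_linear_submod_closed : submod_closed bounded_linear.
Proof.
split.
  apply/asboolP; split; first by move=> a x y /=; rewrite scaler0 addr0.
  by move=> x; exact: cvg_cst.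
move=> a f g /asboolP[lf cf] /asboolP[lg cg]; apply/asboolP; split.
  move=> b x y /=.
  rewrite !fctE lf lg !scalerDr !scalerA [a * b]mulrC -!addrA; congr (_ + _).
  by rewrite addrCA.
by move=> x; apply: continuousD; [apply: continuousZr; exact: cf|exact: cg].
Qed.

HB.instance Definition _ :=
  GRing.isSubmodClosed.Build R[i] (U -> V) bounded_linear
    bounded_linear_submod_closed.

Record bop := Bop { bop_fun :> U -> V; bopP : bop_fun \in bounded_linear }.

HB.instance Definition _ := [isSub for bop_fun].
HB.instance Definition _ := [Choice of bop by <:].
HB.instance Definition _ := [SubChoice_isSubLmodule of bop by <:].

End BoundedOperators.

Arguments bop {R} U V.

Notation "''B(' U , V )" := (bop U V)
  (at level 8, format "''B(' U ,  V )") : type_scope.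
Notation "''B(' U )" := (bop U U) (at level 8, format "''B(' U )") : type_scope.

Section BoundedOperatorTheory.
Context {R : realType} {U V : hilbertType R}.
Implicit Types F G : 'B(U, V).

Lemma bop_linear F : linear F.
Proof. by have /asboolP[] := bopP F. Qed.

Lemma bop_continuous F : continuous F.
Proof. by have /asboolP[] := bopP F. Qed.

HB.instance Definition _ F :=
  GRing.isLinear.Build R[i] U V _ (bop_fun F) (bop_linear F).

Lemma bop_ext F G : F =1 G -> F = G.
Proof. by move=> FG; apply: val_inj; apply/funext. Qed.

Lemma bop0E (x : U) : (0 : 'B(U, V)) x = 0.
Proof. by []. Qed.

Lemma bopDE F G (x : U) : (F + G) x = F x + G x.
Proof. by []. Qed.

Lemma bopNE F (x : U) : (- F) x = - F x.
Proof. by []. Qed.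

Lemma bopZE (a : R[i]) F (x : U) : (a *: F) x = a *: F x.
Proof. by []. Qed.

End BoundedOperatorTheory.

Section Composition.
Context {R : realType} {U V W : hilbertType R}.

Lemma bop_id_subproof : (idfun : U -> U) \in bounded_linear.
Proof. by apply/asboolP; split => // x; exact: cvg_id. Qed.

Definition bop_id : 'B(U) := Bop bop_id_subproof.

Lemma bop_comp_subproof (F : 'B(V, W)) (G : 'B(U, V)) :
  (F \o G) \in bounded_linear.
Proof.
apply/asboolP; split; first by move=> a x y; rewrite /= !linearP.
by move=> x; apply: continuous_comp; exact: bop_continuous.
Qed.

Definition bop_comp (F : 'B(V, W)) (G : 'B(U, V)) : 'B(U, W) :=
  Bop (bop_comp_subproof F G).

End Composition.

Notation "'\Id'" := bop_id : ring_scope.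
Notation "F ∘ G" := (bop_comp F G) (at level 40, left associativity) : ring_scope.

(* The value of [xget] is the operator [G] of the Riesz representation theorem;
   its default [0] is never taken. *)
Definition bop_adj (R : realType) (U V : hilbertType R) (F : 'B(U, V)) :
    'B(V, U) :=
  xget 0 [set G : 'B(V, U) | forall x y, ⟨F x, y⟩ = ⟨x, G y⟩].

Notation "F ^†" := (bop_adj F) (at level 2, format "F ^†") : ring_scope.

(* The order of [R[i]] makes [0 <= z] mean that [z] is real and nonnegative. *)
Definition bop_le (R : realType) (U : hilbertType R) (F G : 'B(U)) : Prop :=
  forall x, 0 <= ⟨(G - F) x, x⟩.

Notation "F ⪯ G" := (bop_le F G) (at level 70, no associativity) : ring_scope.

Definition bop_Re (R : realType) (U : hilbertType R) (K : 'B(U)) : 'B(U) :=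
  2^-1 *: (K + K^†).

Definition bop_Im (R : realType) (U : hilbertType R) (K : 'B(U)) : 'B(U) :=
  (2 * 'i)^-1 *: (K - K^†).

(** * Block operators and the series product *)

Section Generators.
Context {R : realType} {h H : hilbertType R}.

Definition block_fun (K : 'B(h)) (M : 'B(H, h)) (L : 'B(h, H)) (D : 'B(H))
    (x : h ⊕ H) : h ⊕ H :=
  (K x.1 + M x.2, L x.1 + D x.2).

Lemma block_subproof K M L D : block_fun K M L D \in bounded_linear.
Proof.
have lin : linear (block_fun K M L D).
  move=> a x y; congr pair; rewrite /= !linearP scalerDr -!addrA;
    by congr (_ + _); rewrite addrCA.
apply/asboolP; split=> //.
pose f : {linear h ⊕ H -> h ⊕ H} := HB.pack (block_fun K M L D)
  (GRing.isLinear.Build R[i] (h ⊕ H) (h ⊕ H) _ _ lin).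
have bnd (V W : hilbertType R) (F : 'B(V, W)) :
    exists2 r : R[i], 0 <= r & forall x, `|F x| <= r * `|x|.
  have /linear_bounded_continuous/linear_boundedP := @bop_continuous _ _ _ F.
  by move=> /pinfty_ex_gt0[r r0 Fr]; exists r => //; exact: ltW.
have [rK rK0 KP] := bnd _ _ K; have [rM rM0 MP] := bnd _ _ M.
have [rL rL0 LP] := bnd _ _ L; have [rD rD0 DP] := bnd _ _ D.
have : continuous f; last by [].
apply: bounded_linear_continuous; apply/linear_boundedP.
have rR : rK + rM + (rL + rD) \is Num.real.
  by rewrite ger0_real// !addr_ge0.
exists (rK + rM + (rL + rD)); split => // r /ltW rr x.
apply: (@le_trans _ _ ((rK + rM + (rL + rD)) * `|x|)); last first.
  by rewrite ler_wpM2r.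
apply: le_trans (hsum_norm_le _) _; rewrite /= mulrDl.
by apply: lerD; apply: le_trans (ler_normD _ _) _; rewrite mulrDl;
  apply: lerD; [apply: le_trans (KP _) _ | apply: le_trans (MP _) _
               |apply: le_trans (LP _) _ | apply: le_trans (DP _) _];
  rewrite ler_wpM2l// ?hsum_norm1 ?hsum_norm2.
Qed.

Definition block (K : 'B(h)) (M : 'B(H, h)) (L : 'B(h, H)) (D : 'B(H)) :
    'B(h ⊕ H) :=
  Bop (block_subproof K M L D).

Definition Delta : 'B(h ⊕ H) := block 0 0 0 \Id.

Definition Delta_perp : 'B(h ⊕ H) := \Id - Delta.

Definition series_prod (F1 F2 : 'B(h ⊕ H)) : 'B(h ⊕ H) :=
  F1 + F1 ∘ Delta ∘ F2 + F2.

End Generators.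

Notation "F1 ◁ F2" := (series_prod F1 F2)
  (at level 50, left associativity) : ring_scope.

Section GeneratorClasses.
Context {R : realType} {h H : hilbertType R}.

Definition gen_z : set 'B(h ⊕ H) :=
  [set block K 0 0 0 | K in [set: 'B(h)]].

Definition gen_c : set 'B(h ⊕ H) := [set F | F^† ◁ F ⪯ 0].

Definition gen_qc : set 'B(h ⊕ H) :=
  [set F + β%:C%C *: Delta_perp | F in gen_c & β in [set β : R | 0 <= β]].

Definition gen_u : set 'B(h ⊕ H) :=
  [set F | F^† ◁ F = 0 /\ F ◁ F^† = 0].

(* For [h] nonzero the set is bounded below.  For [h] the zero space it is all of
   [R] when [gen_c F]; [inf] is then [0] instead of minus infinity, but only
   [beta0 F] times the identity of [h] matters. *)
Definition beta0 (F : 'B(h ⊕ H)) : R :=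
  inf [set β : R | gen_c (F - β%:C%C *: Delta_perp)].

End GeneratorClasses.

(* Main.v *)
From HB Require Import structures.
Require Import Defs.
From mathcomp Require Import all_boot all_order all_algebra.
From mathcomp Require Import complex ring.
From mathcomp Require Import boolp classical_sets reals topology normedtype.

Set Implicit Arguments.
Unset Strict Implicit.
Unset Printing Implicit Defensive.

Import Order.TTheory GRing.Theory Num.Theory.
Import numFieldNormedType.Exports.

Local Open Scope classical_set_scope.
Local Open Scope ring_scope.

(** The reason is that [F^† ◁ F ⪯ 0] is a statement about one quadratic form.
  With [F = block K M L (C - \Id)], the number [⟨(F^† ◁ F) z, z⟩] at
  [z = (x, y)] is
  [2 Re ⟨K x, x⟩ + 2 Re ⟨M y, x⟩ + |L x + C y|² - |y|²],
  called [qform K M L C x y] below; [F] is in [gen_c] exactly when it is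
  nonpositive everywhere ([gen_c_block]).  Subtracting [β *: Delta_perp] from [F]
  lowers this form by [2 β |x|²].

  The number [beta0 F] is thus the infimum of the real numbers [β] subject to
  inequalities of the form [a ≤ β b] with [b ≥ 0].  These define a closed set that
  is stable under increasing [β], so that the infimum satisfies them
  ([inf_mem_halflines], [gen_c_beta0]): [F - beta0 F *: Delta_perp] is in [gen_c].

  Membership of [F3l] and [F2r] in [gen_c] follows by comparing forms.  That of
  [F3l] equals the form of [F - β0 *: Delta_perp].  Since [F3r] is unitary for the
  series product, [F2r] is [F - β0 *: Delta_perp], up to the skew-adjoint part of
  [K], multiplied on the right by [F3r^†]; on forms this is the substitution of
  [(x, M^† x + y)] for [(x, y)].

  Everything else is block algebra: a block operator has the transposed matrix
  of adjoints as its adjoint ([block_adj]), and the series product has a simple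
  expression on blocks ([block_series]).  These computations need adjoints that
  satisfy their defining identity, hence the Riesz representation theorem
  ([riesz_representation]), which is obtained by minimizing
  [|x|² - 2 Re f x]. *)

(** * Conjugation and the inner product *)

Section Conj.
Context {R : realType}.
Implicit Types a b : R[i].

Lemma conjD a b : (a + b)^* = a^* + b^*. Proof. exact: rmorphD. Qed.
Lemma conjN a : (- a)^* = - a^*. Proof. exact: rmorphN. Qed.
Lemma conjM a b : (a * b)^* = a^* * b^*. Proof. exact: rmorphM. Qed.
Lemma conj0 : (0 : R[i])^* = 0. Proof. exact: rmorph0. Qed.

End Conj.

Definition conjE := (@conjD, @conjN, @conjM, @conj0).

Section InnerProduct.
Context {R : realType} {U : hilbertType R}.
Implicit Types (x y z : U) (a : R[i]).

Lemma hdotDl x y z : ⟨x + y, z⟩ = ⟨x, z⟩ + ⟨y, z⟩.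
Proof. exact: linearDl. Qed.

Lemma hdotDr x y z : ⟨x, y + z⟩ = ⟨x, y⟩ + ⟨x, z⟩.
Proof. exact: linearDr. Qed.

Lemma hdotNl x y : ⟨- x, y⟩ = - ⟨x, y⟩.
Proof. exact: linearNl. Qed.

Lemma hdotNr x y : ⟨x, - y⟩ = - ⟨x, y⟩.
Proof. exact: linearNr. Qed.

Lemma hdotZl a x y : ⟨a *: x, y⟩ = a * ⟨x, y⟩.
Proof. exact: linearZl_LR. Qed.

Lemma hdotZr a x y : ⟨x, a *: y⟩ = a^* * ⟨x, y⟩.
Proof. exact: linearZr_LR. Qed.

Lemma hdotC x y : (⟨x, y⟩)^* = ⟨y, x⟩.
Proof. by rewrite [RHS](hermC hdot) mul1r. Qed.

Lemma hdot0l x : ⟨0, x⟩ = 0.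
Proof. exact: linear0l. Qed.

Lemma hdot0r x : ⟨x, 0⟩ = 0.
Proof. exact: linear0r. Qed.

Definition hdot_linE := (hdotDl, hdotDr, hdotNl, hdotNr, hdotZl, hdotZr,
  hdot0l, hdot0r).

Lemma hdot_inj x y : (forall z, ⟨z, x⟩ = ⟨z, y⟩) -> x = y.
Proof.
move=> xy; apply/eqP; rewrite -subr_eq0 -normr_eq0 -sqrf_eq0 -hdotE.
by rewrite hdotDr hdotNr xy subrr.
Qed.

End InnerProduct.

Lemma addCJ_le (R : realType) (a : R[i]) : a + a^* <= 2 * `|a|.
Proof.
have aR : a + a^* \is Num.real by rewrite CrealE rmorphD/= conjCK addrC.
apply: le_trans (real_ler_norm aR) _; apply: le_trans (ler_normD _ _) _.
by rewrite norm_conjC mulr2n mulrDl mul1r.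
Qed.

Lemma cauchy_schwarz (R : realType) (U : hilbertType R) (x y : U) :
  `|⟨x, y⟩| <= `|x| * `|y|.
Proof.
have [->|y0] := eqVneq y 0; first by rewrite hdot0r !normr0 mulr0.
have ny : 0 < `|y| ^+ 2 by rewrite exprn_gt0// normr_gt0.
rewrite -(@ler_pXn2r _ 2)// ?nnegrE ?mulr_ge0// exprMn -ler_pdivrMr//.
(* The difference is the squared norm of the component of [x] orthogonal
   to [y]. *)
rewrite -subr_ge0; set a := ⟨x, y⟩.
have yy : ⟨y, y⟩ != 0 by rewrite hdotE gt_eqF.
suff -> : `|x| ^+ 2 - `|a| ^+ 2 / `|y| ^+ 2 = `|x - (a / `|y| ^+ 2) *: y| ^+ 2.
  by rewrite exprn_ge0.
rewrite -!hdotE !hdot_linE -/a -(hdotC x y) -/a rmorphM/= normCK.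
have -> : ((⟨y, y⟩)^-1)^* = (⟨y, y⟩)^-1 by rewrite fmorphV/= hdotC.
by field.
Qed.

Lemma normsq_le (R : realType) (U : hilbertType R) (x : U) (e : R[i]) :
  0 <= e -> ⟨x, x⟩ <= e ^+ 2 -> `|x| <= e.
Proof. by move=> e0; rewrite hdotE ler_pXn2r ?nnegrE. Qed.

(** * The Riesz representation theorem *)

(** A bound in the order of [R[i]] forces all the values to have the same
    imaginary part, so that the infimum can be taken over real numbers. *)
Lemma complex_inf (R : realType) (T : Type) (t0 : T) (J : T -> R[i]) (c : R[i]) :
  (forall x, c <= J x) ->
  exists2 m : R[i], (forall x, m <= J x) &
    (forall e, 0 < e -> exists x, J x < m + e).
Proof.
move=> cJ.
have cJE x : J x = c + (complex.Re (J x - c))%:C%C.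
  by rewrite RRe_real ?ger0_real ?subr_ge0//; ring.
set r := fun x => complex.Re (J x - c).
have r0 x : 0 <= r x.
  by rewrite -ler0c /r RRe_real ?ger0_real ?subr_ge0.
have hlb : has_lbound (range r) by exists 0 => _ [x _ <-].
exists (c + (inf (range r))%:C%C).
  by move=> x; rewrite cJE lerD2l lecR; apply: ge_inf => //; exists x.
move=> e e0.
have eE : (complex.Re e)%:C%C = e by rewrite RRe_real// gtr0_real.
have e0' : 0 < complex.Re e by rewrite -ltcR eE.
have [|_ [x _ <-] xe] := inf_adherent e0' (E := range r).
  by split => //; exists (r t0), t0.
by exists x; rewrite cJE -addrA ltrD2l -eE -rmorphD/= ltcR.
Qed.

Section Riesz.
Context {R : realType} {U : hilbertType R}.
Context (f : {linear U -> R[i] | *%R}) (r : R[i]).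
Context (r_ge0 : 0 <= r) (f_bounded : forall x, `|f x| <= r * `|x|).

(** This is [|x - z|² - |z|²] when [z] represents [f], so that [z] is its only
    minimizer. *)
Let J (x : U) : R[i] := ⟨x, x⟩ - (f x + (f x)^*).

(** Completing the square: [J x] is at least [(|x| - r)² - r²]. *)
Let J_ge x : - r ^+ 2 <= J x.
Proof.
have h : f x + (f x)^* <= 2 * (r * `|x|).
  by apply: le_trans (addCJ_le _) _; rewrite ler_wpM2l.
apply: (@le_trans _ _ (`|x| ^+ 2 - 2 * (r * `|x|))); last first.
  by rewrite /J hdotE lerD2l lerN2.
rewrite -subr_ge0.
have -> : `|x| ^+ 2 - 2 * (r * `|x|) - - r ^+ 2 = (`|x| - r) ^+ 2 by ring.
by rewrite real_exprn_even_ge0// realB// ger0_real.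
Qed.

(** The uniform convexity that makes minimizing families Cauchy. *)
Let J_parallelogram x y :
  J x + J y - 2 * J (2^-1 *: (x + y)) = 2^-1 * ⟨x - y, x - y⟩.
Proof.
have h2 : (2^-1 : R[i])^* = 2^-1 by rewrite fmorphV/= conjC_nat.
have fE : f (2^-1 *: (x + y)) = 2^-1 * (f x + f y) by rewrite linearZ/= linearD.
rewrite /J fE rmorphM/= h2 rmorphD/= !hdot_linE h2.
by field.
Qed.

(** The first-order term in [a] vanishes for every [v] exactly when [x]
    represents [f]. *)
Let J_perturb x v a :
  J (x + a *: v) = J x + `|a| ^+ 2 * ⟨v, v⟩ + (a * (⟨v, x⟩ - f v))
    + (a * (⟨v, x⟩ - f v))^*.
Proof.
have fE : f (x + a *: v) = f x + a * f v by rewrite linearD/= linearZ.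
rewrite /J fE normCK !(rmorphM, rmorphD, rmorphN)/= hdotC !hdot_linE.
by ring.
Qed.

(** The near-minimizers of [J] generate a Cauchy filter, because the value of
    [J] at the midpoint of two of them is at least the infimum.  Near-minimizers
    nearly satisfy the first-order condition, and the limit satisfies it by
    continuity of the inner product. *)
Lemma riesz_representation : exists z, forall x, f x = ⟨x, z⟩.
Proof.
have [m mJ Jm] := complex_inf 0 J_ge.
(* The tolerance is squared so that distances and first-order defects are
   linear in [e]. *)
pose S e := [set x | J x < m + e ^+ 2].
pose G := filter_from [set e : R[i] | 0 < e] S.
have S_mono e e' : 0 < e -> e <= e' -> S e `<=` S e'.
  move=> e0 ee' x /lt_le_trans; apply; rewrite lerD2l.
  have e0' : 0 < e' by exact: lt_le_trans ee'.
  by rewrite ler_pXn2r// nnegrE ltW.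
have GF : Filter G.
  apply: filter_from_filter; first by exists 1; exact: ltr01.
  move=> i j /= i0 j0.
  have ij : 0 < i * j / (i + j) by rewrite divr_gt0 ?mulr_gt0 ?addr_gt0.
  (* The order of [R[i]] is partial, so this replaces the minimum of [i]
     and [j]. *)
  exists (i * j / (i + j)) => // x Sx; split; move: x Sx; apply: S_mono => //.
    by rewrite ler_pdivrMr ?addr_gt0// mulrDr lerDr mulr_ge0// ltW.
  by rewrite ler_pdivrMr ?addr_gt0// mulrDr (mulrC j) lerDl mulr_ge0// ltW.
have GP : ProperFilter G.
  apply: filter_from_proper => e /= e0.
  by apply: Jm; rewrite exprn_gt0.
have S_dist e x y : 0 < e -> S e x -> S e y -> `|x - y| <= 2 * e.
  rewrite /S/= => e0 Sx Sy.
  apply: normsq_le; first by rewrite mulr_ge0// ltW.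
  have -> : ⟨x - y, x - y⟩ = 2 * (J x + J y - 2 * J (2^-1 *: (x + y))).
    by rewrite J_parallelogram; field.
  have -> : (2 * e) ^+ 2 = 2 * (m + e ^+ 2 + (m + e ^+ 2) - 2 * m) by ring.
  rewrite ler_pM2l ?ltr0n//; apply: lerD; first by apply: lerD; exact: ltW.
  by rewrite lerN2 ler_pM2l ?ltr0n.
have S_eq e x v : 0 < e -> S e x -> `|⟨v, x⟩ - f v| <= e * `|v|.
  rewrite /S/= => e0 Sx.
  have [->|v0] := eqVneq v 0; first by rewrite hdot0l linear0 subr0 !normr0 mulr0.
  set g := ⟨v, x⟩ - f v.
  have nv : 0 < `|v| by rewrite normr_gt0.
  have e_ge0 := ltW e0.
  rewrite -(@ler_pXn2r _ 2)// ?nnegrE ?mulr_ge0//.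
  rewrite exprMn -ler_pdivrMr ?exprn_gt0//.
  (* This multiple of [v] minimizes the perturbed [J] along the line of [v]. *)
  have := mJ (x + (- (g^* / `|v| ^+ 2)) *: v).
  rewrite J_perturb -/g.
  have -> : `|- (g^* / `|v| ^+ 2)| ^+ 2 * ⟨v, v⟩ = `|g| ^+ 2 / `|v| ^+ 2.
    rewrite normrN normrM norm_conjC normfV normrX normr_id hdotE.
    by field; rewrite gt_eqF.
  have -> : - (g^* / `|v| ^+ 2) * g = - (`|g| ^+ 2 / `|v| ^+ 2).
    by rewrite normCK; field; rewrite gt_eqF.
  have -> : (- (`|g| ^+ 2 / `|v| ^+ 2))^* = - (`|g| ^+ 2 / `|v| ^+ 2).
    by apply: CrealP; rewrite realN ger0_real// divr_ge0// exprn_ge0.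
  rewrite addrK lerBrDr => h; have := le_lt_trans h Sx.
  by rewrite ltrD2l => /ltW.
have Gc : cvg G.
  apply: cauchy_cvg; apply/cauchy_ballP => e e0.
  exists (S (e / 3), S (e / 3)) => /=.
    by split; exists (e / 3) => //=; rewrite divr_gt0.
  move=> [x y] /= [Sx Sy]; rewrite -ball_normE /=.
  apply: le_lt_trans (S_dist _ _ _ _ Sx Sy) _; first by rewrite divr_gt0.
  by rewrite mulrCA gtr_pMr// ltr_pdivrMr// mul1r ltr_nat.
have /cvg_ex[/= z Gz] := Gc.
exists z => v; rewrite -[RHS]/(⟨v, z⟩); apply/eqP; rewrite eq_sym -subr_eq0.
rewrite -normr_eq0 eq_le normr_ge0 andbT.
apply/ler_addgt0Pl => e e0; rewrite addr0.
(* The limit is within [2 d |v|] of the first-order condition; the [1] covers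
   [v = 0]. *)
pose d := e / (1 + 2 * `|v|).
have d0 : 0 < d by rewrite divr_gt0// ltr_pwDl// mulr_ge0.
have Sd : G (S d) by exists d.
have [x [Sx zx]] : exists x, S d x /\ `|z - x| < d.
  have [x [Sx]] := filter_ex (filterI Sd (Gz _ (nbhsx_ballx z d d0))).
  by rewrite -ball_normE; exists x.
have -> : ⟨v, z⟩ - f v = ⟨v, z - x⟩ + (⟨v, x⟩ - f v).
  by rewrite !hdot_linE; ring.
apply: le_trans (ler_normD _ _) _.
apply: (@le_trans _ _ (`|v| * d + d * `|v|)).
  apply: lerD; last exact: S_eq.
  by apply: le_trans (cauchy_schwarz _ _) _; rewrite ler_wpM2l// ltW.
have -> : `|v| * d + d * `|v| = e * ((2 * `|v|) / (1 + 2 * `|v|)).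
  by rewrite /d; field; rewrite gt_eqF// ltr_pwDl// mulr_ge0.
have e_ge0 := ltW e0.
by rewrite ler_piMr// ler_pdivrMr ?ltr_pwDl ?mulr_ge0// mul1r lerDr.
Qed.

End Riesz.

(** * Adjoints *)

Section Adjoint.
Context {R : realType} {U V : hilbertType R}.
Implicit Types F G : 'B(U, V).

Lemma bop_bounded F : exists2 r : R[i], 0 <= r & forall x, `|F x| <= r * `|x|.
Proof.
have /linear_bounded_continuous/linear_boundedP := @bop_continuous _ _ _ F.
by move=> /pinfty_ex_gt0[r r0 Fr]; exists r => //; exact: ltW.
Qed.

(** For each [y], the Riesz theorem represents the functional [⟨F _, y⟩] by a
    vector; uniqueness makes that vector linear in [y], and evaluating the functional
    at it bounds its norm by the bound of [F] times [|y|]. *)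
Lemma bop_adj_exists F :
  exists G : 'B(V, U), forall x y, ⟨F x, y⟩ = ⟨x, G y⟩.
Proof.
have [r r0 Fr] := bop_bounded F.
have /choice[g gE] (y : V) : exists z, forall x, ⟨F x, y⟩ = ⟨x, z⟩.
  have lin : scalar (fun x => ⟨F x, y⟩).
    by move=> a u v; rewrite linearP !hdot_linE.
  pose f : {scalar U} := HB.pack (fun x => ⟨F x, y⟩)
    (GRing.isLinear.Build R[i] U R[i] *%R _ lin).
  apply: (@riesz_representation _ _ f (r * `|y|)); first by rewrite mulr_ge0.
  move=> x; apply: le_trans (cauchy_schwarz _ _) _.
  by rewrite mulrAC ler_wpM2r.
have lin : linear g.
  move=> a u v; apply: hdot_inj => z.
  by rewrite -gE !hdot_linE !gE.
pose g' : {linear V -> U} := HB.pack g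
  (GRing.isLinear.Build R[i] V U _ _ lin).
have cont : continuous g'.
  apply: bounded_linear_continuous; apply/linear_boundedP.
  exists r; split; first exact: ger0_real.
  move=> s /ltW rs y.
  apply: (@le_trans _ _ (r * `|y|)); last by rewrite ler_wpM2r.
  have [gy0|gy0] := eqVneq (g y) 0; first by rewrite /= gy0 normr0 mulr_ge0.
  rewrite -(@ler_pM2l _ `|g y|) ?normr_gt0//= -expr2 -hdotE -gE.
  rewrite -[leLHS]ger0_norm; last by rewrite gE hdotE exprn_ge0.
  apply: le_trans (cauchy_schwarz _ _) _.
  by rewrite mulrCA mulrA ler_wpM2r.
have gP : g \in bounded_linear by apply/asboolP; split.
by exists (Bop gP) => x y; exact: gE.
Qed.

Lemma bop_adjE F x y : ⟨F x, y⟩ = ⟨x, F^† y⟩.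
Proof. exact: (xgetPex 0 (bop_adj_exists F)). Qed.

Lemma bop_adjEr F x y : ⟨x, F y⟩ = ⟨F^† x, y⟩.
Proof. by rewrite -hdotC bop_adjE hdotC. Qed.

Lemma bop_adj_uniq F (G : 'B(V, U)) :
  (forall x y, ⟨F x, y⟩ = ⟨x, G y⟩) -> F^† = G.
Proof.
by move=> FG; apply: bop_ext => y; apply: hdot_inj => x; rewrite -bop_adjE.
Qed.

End Adjoint.

Section AdjointAlgebra.
Context {R : realType}.
Implicit Types U V W : hilbertType R.

Lemma bop_adjK U V (F : 'B(U, V)) : F^†^† = F.
Proof. by apply: bop_adj_uniq => x y; rewrite bop_adjEr. Qed.

Lemma bop_adjN U V (F : 'B(U, V)) : (- F)^† = - F^†.
Proof. by apply: bop_adj_uniq => x y; rewrite !bopNE !hdot_linE !bop_adjE. Qed.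

Lemma bop_adjZ U V (a : R[i]) (F : 'B(U, V)) : (a *: F)^† = a^* *: F^†.
Proof.
by apply: bop_adj_uniq => x y; rewrite !bopZE !hdot_linE !bop_adjE conjCK.
Qed.

Lemma bop_adj0 U V : (0 : 'B(U, V))^† = 0.
Proof. by apply: bop_adj_uniq => x y; rewrite !bop0E !hdot_linE. Qed.

Lemma bop_adj_comp U V W (F : 'B(V, W)) (G : 'B(U, V)) :
  (F ∘ G)^† = G^† ∘ F^†.
Proof.
apply: bop_adj_uniq => x y.
by rewrite -[(F ∘ G) x]/(F (G x)) bop_adjE bop_adjE.
Qed.

End AdjointAlgebra.

Definition adjE :=
  (@bop_adjK, @bop_adjN, @bop_adjZ, @bop_adj0, @bop_adj_comp).

Lemma bop_compE (R : realType) (U V W : hilbertType R)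
  (F : 'B(V, W)) (G : 'B(U, V)) x : (F ∘ G) x = F (G x).
Proof. by []. Qed.

Lemma bop_idE (R : realType) (U : hilbertType R) (x : U) : (\Id : 'B(U)) x = x.
Proof. by []. Qed.

Section Pointwise.
Context {R : realType} {U V : hilbertType R} (F : 'B(U, V)).

Lemma bop_fun0 : F 0 = 0. Proof. exact: linear0. Qed.
Lemma bop_funD x y : F (x + y) = F x + F y. Proof. exact: linearD. Qed.
Lemma bop_funN x : F (- x) = - F x. Proof. exact: linearN. Qed.
Lemma bop_funZ a x : F (a *: x) = a *: F x. Proof. exact: linearZ. Qed.

End Pointwise.

Definition bopE := (@bopDE, @bopNE, @bopZE, @bop0E, @bop_compE, @bop_idE,
  @bop_fun0, @bop_funD, @bop_funN, @bop_funZ).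

(** Reduces identities between operators to identities in the commutative
    ring [R[i]]. *)
Lemma bop_weak_ext (R : realType) (U V : hilbertType R) (F G : 'B(U, V)) :
  (forall x y, ⟨y, F x⟩ = ⟨y, G x⟩) -> F = G.
Proof. by move=> FG; apply: bop_ext => x; apply: hdot_inj => y. Qed.

(** * Block operators and their quadratic forms *)

Section Blocks.
Context {R : realType} {h H : hilbertType R}.
Implicit Types (K : 'B(h)) (M : 'B(H, h)) (L : 'B(h, H)) (C D : 'B(H)).

Lemma block_fst K M L D (z : h ⊕ H) : (block K M L D z).1 = K z.1 + M z.2.
Proof. by []. Qed.

Lemma block_snd K M L D (z : h ⊕ H) : (block K M L D z).2 = L z.1 + D z.2.
Proof. by []. Qed.

Definition blockE := (block_fst, block_snd).

Lemma block_adj K M L D : (block K M L D)^† = block K^† L^† M^† D^†.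
Proof.
apply: bop_adj_uniq => x y; rewrite !hdot_hsumE !blockE !hdot_linE.
by rewrite !bop_adjE; ring.
Qed.

Lemma block_series K1 M1 L1 D1 K2 M2 L2 D2 :
  block K1 M1 L1 D1 ◁ block K2 M2 L2 D2 =
  block (K1 + M1 ∘ L2 + K2) (M1 + M1 ∘ D2 + M2)
        (L1 + D1 ∘ L2 + L2) (D1 + D1 ∘ D2 + D2).
Proof.
apply: bop_weak_ext => x y.
by rewrite !bopE !hdot_linE !hdot_hsumE !(blockE, bopE) !hdot_linE; ring.
Qed.

Lemma block0 : block 0 0 0 0 = 0 :> 'B(h ⊕ H).
Proof.
apply: bop_weak_ext => x y.
by rewrite !hdot_hsumE !blockE !bopE !hdot_linE !addr0.
Qed.

Lemma block_subDelta_perp K M L D (b : R[i]) :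
  block K M L D - b *: Delta_perp = block (K - b *: \Id) M L D.
Proof.
apply: bop_weak_ext => x y.
by rewrite !bopE !hdot_linE !hdot_hsumE !(blockE, bopE) !hdot_linE; ring.
Qed.

Lemma gen_cP (F : 'B(h ⊕ H)) :
  gen_c F <-> forall z, ⟨F z, z⟩ + (⟨F z, z⟩)^* + ⟨(F z).2, (F z).2⟩ <= 0.
Proof.
have E z : ⟨(0 - (F^† ◁ F)) z, z⟩ =
    - (⟨F z, z⟩ + (⟨F z, z⟩)^* + ⟨(F z).2, (F z).2⟩).
  rewrite !bopE !hdot_linE -!bop_adjEr hdotC !hdot_hsumE.
  by rewrite !(blockE, bopE) !hdot_linE; ring.
by split=> + z => /(_ z); rewrite E oppr_ge0.
Qed.

(** The quadratic form of [F^† ◁ F] for [F = block K M L (C - \Id)]; the identity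
    turns the terms in [D = C - \Id] into [|L x + C y|² - |y|²]. *)
Definition qform K M L C (x : h) (y : H) : R[i] :=
  ⟨K x, x⟩ + (⟨K x, x⟩)^* + (⟨M y, x⟩ + (⟨M y, x⟩)^*)
    + ⟨L x + C y, L x + C y⟩ - ⟨y, y⟩.

Lemma gen_c_block K M L C :
  gen_c (block K M L (C - \Id)) <-> forall x y, qform K M L C x y <= 0.
Proof.
have E (z : h ⊕ H) (F := block K M L (C - \Id)) :
    ⟨F z, z⟩ + (⟨F z, z⟩)^* + ⟨(F z).2, (F z).2⟩ = qform K M L C z.1 z.2.
  rewrite hdot_hsumE /qform /F !(blockE, bopE) !hdot_linE.
  rewrite !conjE !hdotC.
  by ring.
split=> [/gen_cP FP x y|FP]; first by have := FP (x, y); rewrite E.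
by apply/gen_cP => z; rewrite E.
Qed.

End Blocks.

(** * The growth bound is attained *)

(** The constraints are closed and stable under increasing [t].  When [S] is
    not bounded below it contains a negative number, hence also [0], which is
    the value of [inf] in that case. *)
Lemma inf_mem_halflines (R : realType) (I : Type) (a b : I -> R[i]) :
  (forall i, 0 <= b i) ->
  let S := [set t : R | forall i, a i <= t%:C%C * b i] in
  S !=set0 -> S (inf S).
Proof.
move=> b0 S S0; have [Slb|Snlb] := pselect (has_lbound S); last first.
  rewrite inf_out; last by case.
  have [t St t0] : exists2 t, S t & t < 0.
    apply: contrapT => nS; apply: Snlb; exists 0 => t St.
    by rewrite leNgt; apply/negP => t0; apply: nS; exists t.
  move=> i; apply: le_trans (St i) _.
  by rewrite ler_wpM2r// lecR ltW.
(* Adding [e / (1 + b i)] to [inf S] costs at most [e] in the constraint [i]. *)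
move=> i; apply/ler_addgt0Pr => e e0.
have d0 : 0 < complex.Re (e / (1 + b i)).
  by rewrite -ltcR RRe_real ?gtr0_real ?divr_gt0 ?ltr_pwDl.
have [t St /ltW tS] := inf_adherent d0 (conj S0 Slb).
apply: le_trans (St i) _.
apply: (@le_trans _ _ (((inf S)%:C%C + e / (1 + b i)) * b i)).
  rewrite ler_wpM2r//.
  have <- : (complex.Re (e / (1 + b i)))%:C%C = e / (1 + b i).
    by rewrite RRe_real// gtr0_real// divr_gt0 ?ltr_pwDl.
  by rewrite -rmorphD/= lecR.
rewrite mulrDl lerD2l -mulrA ler_piMr ?(ltW e0)//.
by rewrite mulrC ler_pdivrMr ?ltr_pwDl// mul1r lerDr.
Qed.

Section GrowthBound.
Context {R : realType} {h H : hilbertType R}.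
Context (K : 'B(h)) (M : 'B(H, h)) (L : 'B(h, H)) (C : 'B(H)).
Let F : 'B(h ⊕ H) := block K M L (C - \Id).

Lemma gen_c_subDelta_perp (b : R) : gen_c (F - b%:C%C *: Delta_perp) <->
  forall z : h ⊕ H, qform K M L C z.1 z.2 <= b%:C%C * (2 * `|z.1| ^+ 2).
Proof.
rewrite block_subDelta_perp.
have qE (z : h ⊕ H) : qform (K - b%:C%C *: \Id) M L C z.1 z.2 =
    qform K M L C z.1 z.2 - b%:C%C * (2 * `|z.1| ^+ 2).
  rewrite /qform !bopE !hdot_linE !conjE !hdotC -hdotE.
  have -> : (b%:C%C : R[i])^* = b%:C%C by apply: conjc_real.
  by ring.
split=> [/gen_c_block bP z|bP]; first by rewrite -subr_le0 -qE.
by apply/gen_c_block => x y; rewrite (qE (x, y)) subr_le0.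
Qed.

Lemma gen_c_beta0 : gen_qc F -> gen_c (F - (beta0 F)%:C%C *: Delta_perp).
Proof.
move=> [G Gc [b _ GbF]]; apply/gen_c_subDelta_perp.
have SE : [set b : R | gen_c (F - b%:C%C *: Delta_perp)] =
    [set b : R | forall z : h ⊕ H,
      qform K M L C z.1 z.2 <= b%:C%C * (2 * `|z.1| ^+ 2)].
  by apply/seteqP; split=> c /gen_c_subDelta_perp.
rewrite /beta0 SE; apply: inf_mem_halflines.
  by move=> z; rewrite mulr_ge0// exprn_ge0.
by exists b; apply/gen_c_subDelta_perp; rewrite -GbF addrK.
Qed.

End GrowthBound.

(** * The decompositions *)

Theorem proposition1p4 (R : realType) (h H : hilbertType R)
    (K : 'B(h)) (M : 'B(H, h)) (L : 'B(h, H)) (C : 'B(H)) (F : 'B(h ⊕ H)) :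
  F = block K M L (C - \Id) ->
  gen_qc F ->
  let β0 : R[i] := (beta0 F)%:C%C in
  let F1 : 'B(h ⊕ H) := block (β0 *: \Id + 'i *: bop_Im K) 0 0 0 in
  let F2l : 'B(h ⊕ H) := block (- (2^-1 *: (L^† ∘ L))) (- L^†) L 0 in
  let F3r : 'B(h ⊕ H) := block (- (2^-1 *: (M ∘ M^†))) M (- M^†) 0 in
  let F3l : 'B(h ⊕ H) :=
    block (bop_Re K + 2^-1 *: (L^† ∘ L) - β0 *: \Id) (M + L^† ∘ C)
          0 (C - \Id) in
  let F2r : 'B(h ⊕ H) :=
    block (bop_Re K + 2^-1 *: (M ∘ M^†) - β0 *: \Id) 0
          (L + C ∘ M^†) (C - \Id) in
  [/\ gen_z F1,
      gen_u F2l /\ gen_u F3r,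
      gen_c F2r /\ gen_c F3l,
      F1 ◁ F2l ◁ F3l = F &
      F = F1 ◁ F2r ◁ F3r].
Proof.
move=> FE qcF β0 F1 F2l F3r F3l F2r.
have h2 : (2^-1 : R[i])^* = 2^-1 by rewrite fmorphV/= conjC_nat.
have iImE : 'i *: bop_Im K = 2^-1 *: (K - K^†).
  by rewrite scalerA invfM mulrCA mulfV ?mulr1// neq0Ci.
have gc : gen_c (block (K - β0 *: \Id) M L (C - \Id)).
  by rewrite -block_subDelta_perp /β0 FE; apply: gen_c_beta0; rewrite -FE.
split.
- by eexists.
- split; split; rewrite block_adj !adjE block_series -[RHS]block0; congr block;
  by apply: bop_weak_ext => x y; rewrite ?h2 !bopE !hdot_linE ?h2; field.
- have gcP := (gen_c_block _ _ _ _).1 gc.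
  split; apply/gen_c_block => x y.
  (* The multiplication by the unitary [F3r^†] on the right acts on forms by this
     substitution. *)
  + apply: le_trans (gcP x (M^† x + y)); rewrite le_eqVlt; apply/predU1P; left.
    rewrite /qform !bopE !hdot_linE !conjE !hdotC h2.
    rewrite -!(bop_adjEr K) -!(bop_adjE K) !(bop_adjE M) !(bop_adjEr M).
    by field.
  + apply: le_trans (gcP x y); rewrite le_eqVlt; apply/predU1P; left.
    rewrite /qform !bopE !hdot_linE !conjE !hdotC h2.
    rewrite -!(bop_adjEr K) -!(bop_adjE K) -!(bop_adjE L) -!(bop_adjEr L).
    by field.
- rewrite FE !block_series; congr block; apply: bop_weak_ext => x y;
  by rewrite ?iImE !bopE !hdot_linE ?h2; field.
- rewrite FE !block_series; congr block; apply: bop_weak_ext => x y;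
  by rewrite ?iImE !bopE !hdot_linE ?h2; field.
Qed.
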